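(* Let $\varepsilon>0$, $C_0<\infty$, $B>0$ and $\sigma^2>0$ be fixed. Then there exist constants $0<c<C<\infty$, depending only on $\varepsilon$ and $C_0$, and an integer $n_0$, depending only on $B$, $\sigma^2$, $\varepsilon$ and $C_0$, such that, for all $n\geqslant n_0$ and every integer $s=s_n$ satisfying $$(1+\varepsilon)\log_2n\leqslant s\leqslant C_0\log_2n,$$ the class $$\mathcal G_{s,B}=\{g:\{0,1\}^s\to[0,1]:\ g\text{ is coordinatewise nondecreasing and }I^{(2)}(g)\leqslant B\}$$ satisfies $$c\,\frac Bs\leqslant R_n^*(\mathcal G_{s,B})\leqslant C\,\frac Bs .$$ The upper bound is attained by the clipped empirical Fourier projection estimator $\widehat g_{D_\sharp}$ on $\{0,1\}^s$, with truncation degree $D_\sharp=D_\sharp(s,n,B,V)$ and $V=\sigma^2+1$.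
   Context: Model (on the $s$-dimensional cube). One observes $Y_j=g(X_j)+\varepsilon_j$, $j=1,\dots,n$, where $X_1,\dots,X_n$ are i.i.d. uniform on $\{0,1\}^s$ (law $\mu$), and $\varepsilon_1,\dots,\varepsilon_n$ are i.i.d., centered, independent of the design, with $\mathbb E e^{t\varepsilon_j}\leqslant\exp(\sigma^2t^2/2)$ for all $t\in\mathbb R$. (The noise variables $\varepsilon_j$ are not to be confused with the constant $\varepsilon$.) Let $\mathcal P_{\sigma^2}$ be the class of all such noise laws. Risk. $\|h\|_2^2=2^{-s}\sum_{x\in\{0,1\}^s}h(x)^2$. For an estimator $\widehat g$ based on $(X_j,Y_j)_{j=1}^n$, $R_{P_\varepsilon}(\widehat g,g)=\mathbb E\|\widehat g-g\|_2^2$, expectation over design and noise with noise law $P_\varepsilon$. For a class $\mathcal A$, $R_n^*(\mathcal A)=\inf_{\widehat g}\sup_{g\in\mathcal A}\sup_{P_\varepsilon\in\mathcal P_{\sigma^2}}R_{P_\varepsilon}(\widehat g,g)$, the infimum being over all estimators based on the sample. ''The upper bound is attained by $\widehat g$'' means that $\sup_{g\in\mathcal A}\sup_{P_\varepsilon\in\mathcal P_{\sigma^2}}R_{P_\varepsilon}(\widehat g,g)$ satisfies the stated upper bound. Fourier--Walsh notation. For $S\subseteq[s]=\{1,\dots,s\}$, $\chi_S(x)=\prod_{i\in S}(2x_i-1)$, $\chi_\emptyset\equiv1$; $\widehat g(S)=\mathbb E[g(X)\chi_S(X)]$ with $X\sim\mu$. The Fourier--Sobolev energy is $I^{(2)}(g)=4\sum_{S\ne\emptyset}|S|\widehat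 g(S)^2=\sum_{i=1}^s\mathbb E[(\Delta_ig(X))^2]$, where $\Delta_ig(x)=g(x^{i\to1})-g(x^{i\to0})$ and $x^{i\to a}$ is $x$ with $i$-th coordinate replaced by $a$. Resolvable degree. $N(s,D)=\sum_{k=0}^D\binom sk$ and $D^*(s,n)=\max\{0\leqslant D\leqslant s: N(s,D)\leqslant n\}$. Estimator. $\widetilde g(S)=\frac1n\sum_{j=1}^nY_j\chi_S(X_j)$, $\widetilde g_D(x)=\sum_{|S|\leqslant D}\widetilde g(S)\chi_S(x)$, and the clipped estimator is $\widehat g_D(x)=\Pi_{[0,1]}\widetilde g_D(x)$ with $\Pi_{[0,1]}(t)=\max(0,\min(t,1))$. The balanced cutoff, defined when $D^*(s,n)\geqslant1$ and the set is nonempty, is $$D_\sharp(s,n,B,V)=\max\Big\{0\leqslant D\leqslant D^*(s,n):\ \frac{V\,N(s,D)}{n}\leqslant\frac{B}{4D^*(s,n)}\Big\}.$$ *)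

(* Defs.v *)
From HB Require Import structures.
From mathcomp Require Import all_boot all_order all_algebra finmap.
From mathcomp Require Import all_classical all_reals all_analysis.

Set Implicit Arguments.
Unset Strict Implicit.
Unset Printing Implicit Defensive.
Import Order.TTheory GRing.Theory Num.Theory.
Import numFieldNormedType.Exports.

Local Open Scope classical_set_scope.
Local Open Scope ring_scope.

Section prod_law.
Context d1 d2 (T1 : measurableType d1) (T2 : measurableType d2) (R : realType).
Context (P : probability T1 R) (Q : probability T2 R).

Definition prod_law : set (T1 * T2) -> \bar R := (P \x Q)%E.

HB.instance Definition _ := Measure.on prod_law.

Let prod_lawT : prod_law [set: _] = 1%E.
Proof.
rewrite /prod_law -setXTT product_measure1E//.
by rewrite /= !probability_setT mule1.
Qed.

HB.instance Definition _ :=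
  Measure_isProbability.Build _ _ _ prod_law prod_lawT.
End prod_law.

Section iid.
Context d (T : measurableType d) (R : realType).

Definition cons_pair n (w : T * n.-tuple T) : n.+1.-tuple T :=
  [the n.+1.-tuple T of w.1 :: w.2].

Lemma measurable_cons_pair n : measurable_fun setT (@cons_pair n).
Proof. exact: measurable_cons. Qed.

HB.instance Definition _ n :=
  isMeasurableFun.Build _ _ _ _ (@cons_pair n) (@measurable_cons_pair n).

(* The [n]-fold product of [P], as a law on [n.-tuple T]; it is characterized
   by [iid_law_box]. *)
Fixpoint iid_law (P : probability T R) n : probability (n.-tuple T) R :=
  if n is n'.+1 then distribution (prod_law P (iid_law P n')) (@cons_pair n')
  else \d_([tuple] : 0.-tuple T).

Lemma measurable_box n (A : 'I_n -> set T) : (forall i, measurable (A i)) ->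
  measurable [set w : n.-tuple T | forall i, A i (tnth w i)].
Proof.
move=> mA.
rewrite (_ : [set _ | _] = \bigcap_(i in [set: 'I_n]) ((@tnth n T ^~ i) @^-1` A i)).
  apply: fin_bigcap_measurable => // i _; rewrite -[X in measurable X]setTI.
  exact: measurable_tnth.
by apply/seteqP; split => w /= Aw; [move=> i _|move=> i]; exact: Aw.
Qed.

Lemma iid_law_box (P : probability T R) n (A : 'I_n -> set T) :
  (forall i, measurable (A i)) ->
  iid_law P n [set w : n.-tuple T | forall i, A i (tnth w i)]
  = (\prod_(i < n) P (A i))%E.
Proof.
elim: n A => [|n IH] A mA.
  by rewrite big_ord0 /= diracE mem_set// => -[].
rewrite big_ord_recl /= /distribution /pushforward.
rewrite (_ : _ @^-1` _ = A ord0 `*`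
    [set w : n.-tuple T | forall i, A (lift ord0 i) (tnth w i)]).
  rewrite /prod_law product_measure1E//=; first by congr (_ * _)%E; exact: IH.
  exact: (@measurable_box n (fun i => A (lift ord0 i)) (fun i => mA _)).
apply/seteqP; split => -[x w] /=.
  by move=> Aw; split => [|i]; [exact: (Aw ord0)|have := Aw (lift ord0 i); rewrite tnthS].
move=> [A0 Aw] i; have [->//|] := eqVneq i ord0.
by case: (unliftP ord0 i) => [j -> _|->]; rewrite ?eqxx// tnthS.
Qed.

End iid.

Definition cube (s : nat) := s.-tuple bool.

HB.instance Definition _ s := Finite.on (cube s).
HB.instance Definition _ s := Measurable.on (cube s).

(* x^{i -> a} *)
Definition set_coord s (x : cube s) (i : 'I_s) (a : bool) : cube s :=
  [tuple if j == i then a else tnth x j | j < s].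

Section uniform.
Context (R : realType) (s : nat).

Definition uniform_cube : set (cube s) -> \bar R :=
  mscale ((2 ^+ s)^-1)%:nng (@counting (cube s) R).

HB.instance Definition _ := Measure.on uniform_cube.

Let uniform_cubeT : uniform_cube [set: _] = 1%E.
Proof.
rewrite /uniform_cube /mscale /= /counting asboolT; last exact: finite_finset.
rewrite (_ : [set: _] = [set` seq_fset tt (enum (@predT (cube s)))]); last first.
  by apply/seteqP; split=> // x _; rewrite mksetE seq_fsetE mem_enum.
rewrite set_fsetK size_seq_fset undup_id ?enum_uniq// -cardE card_tuple.
by rewrite card_bool natrX /= -EFinM mulVf// expf_neq0// pnatr_eq0.
Qed.

HB.instance Definition _ :=
  Measure_isProbability.Build _ _ _ uniform_cube uniform_cubeT.

End uniform.
Arguments uniform_cube R s : clear implicits.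

Lemma cubeP s (A : set (cube s)) : measurable A.
Proof.
have m1 (x : cube s) : measurable [set x].
  rewrite (_ : [set x] = [set w : s.-tuple bool | forall i, [set tnth x i] (tnth w i)]).
    exact: (@measurable_box _ _ s (fun i => [set tnth x i])).
  by apply/seteqP; split => [w /= -> //|w /= xw]; apply: eq_from_tnth.
rewrite (_ : A = \bigcup_(x in A) [set x]); last first.
  by apply/seteqP; split=> [x Ax|x [y Ay ->]]//; exists x.
by apply: fin_bigcup_measurable => //; exact: finite_finset.
Qed.

Lemma expectation_uniform_cube (R : realType) s (h : cube s -> R) :
  'E_(uniform_cube R s)[h]%E = ((2 ^+ s)^-1 * \sum_(x : cube s) h x)%:E.
Proof.
have mh D : measurable_fun D h by move=> ? ? ?; exact: cubeP.
rewrite unlock.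
have cubeE : [set: cube s] = \big[setU/set0]_(x <- index_enum (cube s)) [set x].
  rewrite -bigcup_seq; apply/seteqP; split=> // x _ /=; exists x => //=.
  by rewrite mem_index_enum.
rewrite [in LHS]cubeE integral_bigsetU_EFin//; first last.
- by rewrite -cubeE; move=> ? ? ?; exact: cubeP.
- by move=> x y _ _ [z [/= -> ->]].
- exact: index_enum_uniq.
- by move=> x; exact: cubeP.
rewrite mulr_sumr -sumEFin; apply: eq_bigr => x _.
rewrite (eq_integral (cst (h x)%:E)); last by move=> y; rewrite inE => ->.
rewrite integral_cst; last exact: cubeP.
rewrite [X in (_ * X)%E](_ : _ = ((2 ^+ s)^-1)%:E) -?EFinM 1?mulrC//.
rewrite -[LHS]/(uniform_cube R s [set x]) /uniform_cube /mscale /=.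
by rewrite /counting asboolT// fset_set1 cardfs1 mule1.
Qed.

Section walsh.
Context (R : realType) (s : nat).
Implicit Types (g h : cube s -> R) (S : {set 'I_s}) (x : cube s).

Definition walsh S x : R := \prod_(i in S) (2 * (tnth x i)%:R - 1).

Definition fourier g S : R :=
  fine 'E_(uniform_cube R s)[fun x => (g x * walsh S x)%R]%E.

Definition sobolev_energy g : R :=
  4 * \sum_(S : {set 'I_s} | S != finset.set0) #|S|%:R * fourier g S ^+ 2.

Definition sqnorm2 h : R := (2 ^+ s)^-1 * \sum_(x : cube s) h x ^+ 2.

Definition coord_nondecreasing g : Prop :=
  forall (i : 'I_s) x, g (set_coord x i false) <= g (set_coord x i true).

Definition mono_class (B : R) : set (cube s -> R) :=
  [set g | [/\ forall x, 0 <= g x <= 1, coord_nondecreasing g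
             & sobolev_energy g <= B]].

End walsh.

Section model.
Context (R : realType).

Definition noise_class (sigma2 : R) : set (probability (measurableTypeR R) R) :=
  [set P : probability (measurableTypeR R) R |
    [/\ P.-integrable [set: measurableTypeR R] (fun e => (e : R)%:E),
        ('E_P[fun e => e] = 0)%E
      & forall t : R,
          ('M_P (fun e => e) t <= (expR (sigma2 * t ^+ 2 / 2))%:E)%E]].

Section sample.
Context (s n : nat).

Local Notation sample := (n.-tuple (cube s * measurableTypeR R)).

(* Law of [(X_j, eps_j)_j]: i.i.d. pairs with independent components. *)
Definition design_noise_law (P : probability (measurableTypeR R) R) :
  probability sample R := iid_law (prod_law (uniform_cube R s) P) n.

(* From [(X_j, eps_j)_j] to [(X_j, Y_j)_j]. *)
Definition observe (g : cube s -> R) (w : sample) : sample :=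
  [tuple ((tnth w j).1, g (tnth w j).1 + (tnth w j).2) | j < n].

Definition estimator : set (sample -> cube s -> R) :=
  [set gh | forall x, measurable_fun [set: sample] (fun z => gh z x)].

Definition risk (P : probability (measurableTypeR R) R)
    (gh : sample -> cube s -> R) (g : cube s -> R) : \bar R :=
  'E_(design_noise_law P)[
    fun w => sqnorm2 (fun x => (gh (observe g w) x - g x)%R)]%E.

Definition worst_risk (sigma2 : R) (A : set (cube s -> R))
    (gh : sample -> cube s -> R) : \bar R :=
  ereal_sup [set ereal_sup [set risk P gh g | P in noise_class sigma2]
            | g in A].

Definition minimax_risk (sigma2 : R) (A : set (cube s -> R)) : \bar R :=
  ereal_inf [set worst_risk sigma2 A gh | gh in estimator].

Definition emp_fourier (z : sample) (S : {set 'I_s}) : R :=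
  n%:R^-1 * \sum_(j < n) (tnth z j).2 * walsh R S (tnth z j).1.

Definition fourier_proj (D : nat) (z : sample) (x : cube s) : R :=
  \sum_(S : {set 'I_s} | (#|S| <= D)%N) emp_fourier z S * walsh R S x.

Definition clip01 (t : R) : R := Num.max 0 (Num.min t 1).

Definition clipped_proj (D : nat) (z : sample) (x : cube s) : R :=
  clip01 (fourier_proj D z x).

End sample.

Definition nb_coeffs (s D : nat) : nat := (\sum_(0 <= k < D.+1) 'C(s, k))%N.

(* Meaningful for [1 <= n], where [D = 0] qualifies. *)
Definition resolvable_degree (s n : nat) : nat :=
  (\max_(D < s.+1 | (nb_coeffs s D <= n)%N) D)%N.

Definition balanced (s n : nat) (B V : R) (D : nat) : bool :=
  V * (nb_coeffs s D)%:R / n%:R <= B / (4 * (resolvable_degree s n)%:R).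

(* Meaningful only under [cutoff_defined]; the empty maximum is [0]. *)
Definition balanced_cutoff (s n : nat) (B V : R) : nat :=
  (\max_(D < (resolvable_degree s n).+1 | balanced s n B V D) D)%N.

Definition cutoff_defined (s n : nat) (B V : R) : Prop :=
  (1 <= resolvable_degree s n)%N /\
  exists2 D, (D <= resolvable_degree s n)%N & balanced s n B V D.

Definition log2 (x : R) : R := ln x / ln 2.

End model.

(* Main.v *)
From HB Require Import structures.
Require Import Defs.
From mathcomp Require Import all_boot all_order all_algebra.
From mathcomp Require Import all_classical all_reals all_analysis.
From mathcomp Require Import measurable_realfun ring lra zify.

Set Implicit Arguments.
Unset Strict Implicit.
Unset Printing Implicit Defensive.
Import Order.TTheory GRing.Theory Num.Theory.
Import numFieldNormedType.Exports.

Local Open Scope classical_set_scope.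
Local Open Scope ring_scope.

(** Upper bound. Since [g] takes its values in [[0, 1]], clipping only brings
the projection closer to [g], and by Parseval the loss of the projection is the
sum of the squared errors on the coefficients of degree at most [D] and of the
mass of [g] above [D]. Each empirical coefficient is an average of [n]
independent variables of variance at most [sigma2 + 1] (the noise has variance
at most [sigma2] by its exponential moments), and the mass above [D] is at most
[B / (4 (D + 1))] because a frequency [S] has weight [4 |S|] in the energy.
Hence [clipped_proj_risk_le]: the risk is at most
[(sigma2 + 1) N(s, D) / n + B / (4 (D + 1))]. At the balanced cutoff the first
term is at most [B / (4 r)], with [r] the resolvable degree, so it remains to
bound [r] and the cutoff from below by a constant times [s]. As
[s <= C0 log2 n], a Chernoff bound on the binomial coefficients
([nb_coeffs_sqr_le]) gives [N(s, delta s) <= sqrt n] for some [delta] depending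
only on [C0]; such a degree is resolvable, and balanced once [sqrt n] exceeds a
multiple of [log n].

Lower bound. As [n] is at most half of the [2^s] points of the cube, each point
escapes the design with probability at least [1/2]. Take functions equal to
[0] below the middle layer, to [a] above it, and to an arbitrary choice of [0]
or [a] at each point of the layer: they are monotone, and a flip of a coordinate
changes their value only along edges touching the layer, so that their energy
is at most [2 a^2 s M / 2^s], where [M] is the size of the layer. Averaging over
all choices, the value at an unobserved point of the layer costs at least
[a^2 / 4] to any estimator, whence a risk of at least [a^2 M / (8 2^s)]
([minimax_risk_ge]). With the largest admissible [a] this equals [B / (16 s)],
whatever [M] is. The size of [M], of order [2^s / sqrt s], only serves to make
[a <= 1] for large [s]. *)

(** * Fourier-Walsh analysis on the cube *)

Section walsh_theory.
Context (R : realType) (s : nat).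
Implicit Types (g h : cube s -> R) (S T : {set 'I_s}) (x y : cube s).

Definition flip x (i : 'I_s) : cube s := set_coord x i (~~ tnth x i).

Lemma tnth_set_coord x i a j :
  tnth (set_coord x i a) j = if j == i then a else tnth x j.
Proof. by rewrite tnth_mktuple. Qed.

Lemma flipK i : involutive (flip ^~ i).
Proof.
move=> x; apply: eq_from_tnth => j; rewrite !tnth_set_coord eqxx.
by case: eqVneq => // ->; rewrite negbK.
Qed.

Lemma walsh_sqr S x : walsh R S x * walsh R S x = 1.
Proof.
rewrite /walsh -big_split big1//= => i _.
by case: (tnth x i); rewrite /=; ring.
Qed.

Lemma walsh_flip S x i :
  walsh R S (flip x i) = if i \in S then - walsh R S x else walsh R S x.
Proof.
rewrite /walsh; case: ifPn => iS.
  rewrite (bigD1 i)//= [in RHS](bigD1 i)//= -mulNr; congr (_ * _).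
    by rewrite tnth_set_coord eqxx; case: (tnth x i); rewrite /=; ring.
  by apply: eq_bigr => j /andP[_ /negPf ji]; rewrite tnth_set_coord ji.
apply: eq_bigr => j jS; rewrite tnth_set_coord; case: eqVneq => // ji.
by move: iS; rewrite -ji jS.
Qed.

Lemma sum_flip i (F : cube s -> R) : \sum_x F (flip x i) = \sum_x F x.
Proof. by rewrite [RHS](reindex_inj (inv_inj (@flipK i))). Qed.

(** Flipping a coordinate lying in exactly one of [S] and [T] changes the sign
of the summand, so the sum is its own opposite. *)
Lemma walsh_orthogonal S T :
  \sum_x walsh R S x * walsh R T x = if S == T then 2 ^+ s else 0.
Proof.
case: eqVneq => [->|ST].
  under eq_bigr do rewrite walsh_sqr.
  by rewrite sumr_const card_tuple card_bool natrX.
have [i iST] : exists i, (i \in S) != (i \in T).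
  apply/existsP; apply: contraR ST; rewrite negb_exists => /forallP ST.
  by apply/eqP/setP => i; have := ST i; rewrite negbK => /eqP.
have /eqP : \sum_x walsh R S x * walsh R T x
           = - \sum_x walsh R S x * walsh R T x.
  rewrite -[LHS](sum_flip i) -sumrN; apply: eq_bigr => x _.
  by rewrite !walsh_flip; move: iST; do 2 case: ifP => //; rewrite ?mulNr ?mulrN.
by rewrite -subr_eq0 opprK -mulr2n mulrn_eq0 => /eqP.
Qed.

(** The sum over [S] expands the product over [i] of [1 + x_i y_i], where the
coordinates are read in [{-1, 1}]; a factor vanishes unless [x = y]. *)
Lemma walsh_complete x y :
  \sum_S walsh R S x * walsh R S y = if x == y then 2 ^+ s else 0.
Proof.
pose e (i : 'I_s) : R := (2 * (tnth x i)%:R - 1) * (2 * (tnth y i)%:R - 1).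
transitivity (\prod_i (e i + 1)).
  rewrite bigA_distr; apply: eq_bigr => S _.
  rewrite /walsh -big_split/= [LHS]big_mkcond/=.
  by apply: eq_bigr => i _; case: ifP.
case: eqVneq => [xy|xy].
  rewrite -[s in RHS]card_ord -prodr_const; apply: eq_bigr => i _.
  by rewrite /e xy; case: (tnth y i); rewrite /=; ring.
have [i xyi] : exists i, tnth x i != tnth y i.
  apply/existsP; apply: contraR xy; rewrite negb_exists => /forallP xy.
  by apply/eqP/eq_from_tnth => i; have := xy i; rewrite negbK => /eqP.
rewrite (bigD1 i)//= [X in X * _](_ : _ = 0) ?mul0r// /e.
by move: xyi; case: (tnth x i); case: (tnth y i) => //= _; ring.
Qed.

Lemma pow2s_neq0 : 2 ^+ s != 0 :> R.
Proof. by rewrite expf_neq0// pnatr_eq0. Qed.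

Lemma fourierE g S :
  fourier g S = (2 ^+ s)^-1 * \sum_x g x * walsh R S x.
Proof. by rewrite /fourier expectation_uniform_cube. Qed.

Lemma fourier_inversion g x : g x = \sum_S fourier g S * walsh R S x.
Proof.
under eq_bigr do rewrite fourierE -mulrA mulr_suml.
rewrite -mulr_sumr exchange_big/=.
under eq_bigr => y _.
  under eq_bigr do rewrite -mulrA.
  rewrite -mulr_sumr walsh_complete.
  over.
rewrite (bigD1 x)//= eqxx big1 ?addr0; last first.
  by move=> y /negPf ->; rewrite mulr0.
by rewrite mulrCA mulVf ?mulr1// pow2s_neq0.
Qed.

Lemma sqnorm2_walsh_sum (c : {set 'I_s} -> R) :
  sqnorm2 (fun x => \sum_S c S * walsh R S x) = \sum_S c S ^+ 2.
Proof.
rewrite /sqnorm2.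
under eq_bigr => x _.
  rewrite expr2 mulr_suml.
  under eq_bigr do rewrite mulr_sumr.
  over.
rewrite exchange_big/=.
under eq_bigr => S _.
  rewrite exchange_big/= (bigD1 S)//= [X in _ + X]big1; last first.
    move=> T /negPf ST.
    under eq_bigr do rewrite mulrACA.
    by rewrite -mulr_sumr walsh_orthogonal eq_sym ST mulr0.
  under eq_bigr do rewrite mulrACA.
  rewrite -mulr_sumr walsh_orthogonal eqxx addr0.
  over.
rewrite -mulr_suml mulrCA mulVf ?pow2s_neq0// mulr1.
by apply: eq_bigr => S _; rewrite expr2.
Qed.

Lemma parseval g : sqnorm2 g = \sum_S fourier g S ^+ 2.
Proof.
rewrite -sqnorm2_walsh_sum; congr sqnorm2.
by apply/funext => x; exact: fourier_inversion.
Qed.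

Lemma fourier_flip g i S :
  fourier (fun x => g (flip x i)) S
  = if i \in S then - fourier g S else fourier g S.
Proof.
rewrite !fourierE -(sum_flip i) -mulrN -sumrN.
rewrite -(fun_if (fun t => (2 ^+ s)^-1 * t)); congr (_ * _).
rewrite [in RHS](_ : (if _ then _ else _)
    = \sum_x (if i \in S then - (g x * walsh R S x) else g x * walsh R S x)).
  by apply: eq_bigr => x _; rewrite flipK walsh_flip; case: ifP; rewrite ?mulrN.
by case: ifP.
Qed.

(** The difference [g - g o flip_i] has Fourier coefficients [2 ghat(S)] for
[S] containing [i], and zero otherwise; its square is that of [Delta_i g]. *)
Lemma sobolev_energyE g :
  sobolev_energy g = \sum_i sqnorm2 (fun x => g x - g (flip x i)).
Proof.
transitivity (\sum_(i < s) \sum_(S : {set 'I_s}) (i \in S)%:R * (4 * fourier g S ^+ 2)).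
  rewrite exchange_big/= /sobolev_energy mulr_sumr [RHS](bigD1 finset.set0)//=.
  rewrite [X in _ = X + _]big1 ?add0r; last by move=> i _; rewrite finset.in_set0 mul0r.
  apply: eq_bigr => S _; rewrite -mulr_suml mulrCA; congr (_ * _).
  by rewrite -sum1_card natr_sum big_mkcond/=; apply: eq_bigr => i _; case: ifP.
apply: eq_bigr => i _; rewrite parseval; apply: eq_bigr => S _.
have -> : fourier (fun x => g x - g (flip x i)) S
          = fourier g S - fourier (fun x => g (flip x i)) S.
  by rewrite !fourierE -mulrBr -sumrB; congr (_ * _); apply: eq_bigr => x _;
     rewrite mulrBl.
by rewrite fourier_flip; case: ifP => _ /=; ring.
Qed.

(** Every frequency above [D] weighs at least [D + 1] in the energy. *)
Lemma fourier_tail_le g (B : R) D : sobolev_energy g <= B ->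
  \sum_(S : {set 'I_s} | ~~ (#|S| <= D)%N) fourier g S ^+ 2 <= B / (4 * D.+1%:R).
Proof.
move=> gB; rewrite ler_pdivlMr ?mulr_gt0 ?ltr0n// (le_trans _ gB)//.
rewrite /sobolev_energy mulrCA ler_pM2l ?ltr0n// mulr_suml.
rewrite [X in X <= _]big_mkcond [X in _ <= X]big_mkcond/=; apply: ler_sum => S _.
case: ifPn => [|_]; last by case: ifP => // _; rewrite mulr_ge0 ?ler0n ?sqr_ge0.
rewrite -ltnNge => DS; rewrite ifT; last by rewrite -card_gt0 (leq_trans _ DS).
by rewrite mulrC ler_wpM2r ?sqr_ge0// ler_nat.
Qed.

End walsh_theory.

(** * Second moments of sums of independent variables *)

Section moments.
Context (R : realType).
Local Open Scope ereal_scope.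

Lemma integral_prod_law d1 d2 (T1 : measurableType d1) (T2 : measurableType d2)
    (P : probability T1 R) (Q : probability T2 R) (f : T1 * T2 -> \bar R) :
  measurable_fun [set: T1 * T2] f -> (forall z, 0 <= f z) ->
  \int[prod_law P Q]_z f z = \int[P]_x \int[Q]_y f (x, y).
Proof. by move=> mf f0; exact: fubini_tonelli1. Qed.

Lemma integral_prod_law2 d1 d2 (T1 : measurableType d1) (T2 : measurableType d2)
    (P : probability T1 R) (Q : probability T2 R) (f : T1 * T2 -> \bar R) :
  measurable_fun [set: T1 * T2] f -> (forall z, 0 <= f z) ->
  \int[prod_law P Q]_z f z = \int[Q]_y \int[P]_x f (x, y).
Proof. by move=> mf f0; exact: fubini_tonelli2. Qed.

Lemma integral_prob_cst d (T : measurableType d) (P : probability T R)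
  (c : R) : \int[P]_x c%:E = c%:E.
Proof.
transitivity (c%:E * P setT); first exact: integral_cst.
by rewrite probability_setT mule1.
Qed.

(** A variable with finite second moment under a probability is integrable,
since [|h| <= 1 + h^2]. *)
Lemma integrable_of_sqr d (T : measurableType d) (P : probability T R)
    (h : T -> R) (v : R) : measurable_fun setT h ->
  \int[P]_x (h x ^+ 2)%:E = v%:E ->
  P.-integrable setT (EFin \o h) /\ P.-integrable setT (fun x => (h x ^+ 2)%:E).
Proof.
move=> mh hv.
have mh2 : measurable_fun setT (fun x => (h x ^+ 2)%:E).
  by apply/measurable_EFinP; exact: measurable_funX.
have ih2 : P.-integrable setT (fun x => (h x ^+ 2)%:E).
  apply/integrableP; split => //.
  under eq_integral do rewrite gee0_abs ?lee_fin ?sqr_ge0//.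
  by rewrite hv ltry.
split=> //; apply: (@le_integrable _ _ _ _ _ _ _ (fun x => 1%:E + (h x ^+ 2)%:E)).
- exact: measurableT.
- exact/measurable_EFinP.
- move=> x _; rewrite /= !lee_fin/= [leRHS]ger0_norm; last first.
    by rewrite addr_ge0// sqr_ge0.
  have := sqr_ge0 (`|h x| - 1)%R; rewrite sqrrB real_normK ?num_real//.
  have := sqr_ge0 (h x); lra.
- apply: integrableD => //.
  exact: (@finite_measure_integrable_cst _ _ _ P _ 1%R).
Qed.

Lemma affine_second_moment d (T : measurableType d) (P : probability T R)
    (h : T -> R) (v a b : R) : measurable_fun setT h ->
  \int[P]_x (h x)%:E = 0 -> \int[P]_x (h x ^+ 2)%:E = v%:E ->
  \int[P]_x ((a + b * h x) ^+ 2)%:E = (a ^+ 2 + b ^+ 2 * v)%:E.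
Proof.
move=> mh h0 hv; have [ih ih2] := integrable_of_sqr mh hv.
have ia : P.-integrable setT (EFin \o cst (a ^+ 2)%R).
  exact: finite_measure_integrable_cst.
have ibh := integrableZl measurableT (2 * a * b)%R ih.
have ibh2 := integrableZl measurableT (b ^+ 2)%R ih2.
transitivity (\int[P]_x ((a ^+ 2)%:E +
    ((2 * a * b)%:E * (h x)%:E + (b ^+ 2)%:E * (h x ^+ 2)%:E))).
  by apply: eq_integral => x _; rewrite -!EFinM -!EFinD; congr EFin; ring.
rewrite integralD//; last exact: integrableD.
rewrite integralD// !integralZl// h0 hv integral_prob_cst.
by rewrite mule0 add0e -EFinM -EFinD.
Qed.

Lemma integral_iidS d (T : measurableType d) (P : probability T R) n
    (f : n.+1.-tuple T -> \bar R) :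
  measurable_fun setT f -> (forall w, 0 <= f w) ->
  \int[iid_law P n.+1]_w f w
  = \int[iid_law P n]_w \int[P]_x f [the n.+1.-tuple T of x :: w].
Proof.
move=> mf f0; rewrite /= ge0_integral_pushforward//=.
rewrite preimage_setT integral_prod_law2//.
  by apply: measurableT_comp => //; exact: measurable_cons_pair.
Qed.

Lemma measurable_sum_tnth d (T : measurableType d) n (h : T -> R) :
  measurable_fun setT h ->
  measurable_fun setT (fun w : n.-tuple T => \sum_(j < n) h (tnth w j))%R.
Proof.
move=> mh; apply: measurable_sum => j.
by apply: (measurableT_comp mh); exact: measurable_tnth.
Qed.

(** Integrating out the first observation with the others held fixed kills
the cross term, so that Tonelli's theorem for nonnegative functions is enough
for the induction. *)
Lemma iid_sum_second_moment d (T : measurableType d) (P : probability T R)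
    (h : T -> R) (v : R) n : measurable_fun setT h ->
  \int[P]_x (h x)%:E = 0 -> \int[P]_x (h x ^+ 2)%:E = v%:E ->
  \int[iid_law P n]_w ((\sum_(j < n) h (tnth w j)) ^+ 2)%:E = (n%:R * v)%:E.
Proof.
move=> mh h0 hv; elim: n => [|n IH].
  under eq_integral do rewrite big_ord0 expr0n/=.
  by rewrite integral0 mul0r.
have msum k : measurable_fun setT
    (fun w : k.-tuple T => ((\sum_(j < k) h (tnth w j)) ^+ 2)%:E).
  apply/measurable_EFinP; apply: measurable_funX.
  exact: measurable_sum_tnth.
have v0 : (0 <= v)%R.
  by rewrite -lee_fin -hv integral_ge0// => x _; rewrite lee_fin sqr_ge0.
rewrite integral_iidS//; last by move=> w; rewrite lee_fin sqr_ge0.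
transitivity (\int[iid_law P n]_w
    (((\sum_(j < n) h (tnth w j)) ^+ 2)%:E + v%:E)).
  apply: eq_integral => w _.
  have := affine_second_moment (\sum_(j < n) h (tnth w j))%R 1 mh h0 hv.
  rewrite expr1n mul1r EFinD => <-; apply: eq_integral => x _.
  rewrite big_ord_recl mul1r addrC tnth0; congr (((_ + _) ^+ 2)%:E).
  by apply: eq_bigr => j _; rewrite tnthS.
rewrite ge0_integralD//; [|by move=> w _; rewrite lee_fin sqr_ge0|exact: msum].
rewrite IH integral_prob_cst -EFinD.
by congr EFin; rewrite -[n.+1]addn1 natrD; ring.
Qed.

Lemma expR_ge_quad (z : R) : (0 <= z -> 1 + z + z ^+ 2 / 2 <= expR z)%R.
Proof.
move=> z0.
have /= := @nondecreasing_cvgn_le _ (series (exp_coeff z)) _ _ 3.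
rewrite /series/= !big_nat_recr//= big_nil /exp_coeff/= add0r.
rewrite !factS fact0 expr0 expr1 !divr1; apply.
- apply/nondecreasing_seqP => n; rewrite /series/= big_nat_recr//= lerDl.
  by rewrite exp_coeff_ge0.
- exact: is_cvg_series_exp_coeff.
Qed.

(** With [y = 2 z], the difference of the two sides is
[(exp z - exp (- z))^2 - (2 z)^2], so for [z >= 0] this is [z <= sinh z]. *)
Lemma quad_le_cosh (y : R) : (2 + y ^+ 2 <= expR y + expR (- y))%R.
Proof.
wlog y0 : y / (0 <= y)%R.
  move=> H; have [/H//|/ltW y0] := leP 0%R y.
  have := H (- y)%R; rewrite sqrrN opprK [(expR (- y) + _)%R]addrC; apply.
  by rewrite oppr_ge0.
pose z := (y / 2)%R; have z0 : (0 <= z)%R by rewrite divr_ge0.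
have -> : y = (z + z)%R by rewrite /z; field.
have /= Ez := expR_ge_quad z0.
rewrite opprD !expRD; set a := expR z in Ez *; set b := expR (- z).
have ab : (a * b = 1)%R by rewrite /a /b expRN divff// gt_eqF// expR_gt0.
have b0 : (0 < b)%R by exact: expR_gt0.
have : (2 * z <= a - b)%R.
  have bq : (b * (1 + z + z ^+ 2 / 2) <= 1)%R.
    by rewrite -[X in (_ <= X)%R]ab (mulrC a) ler_wpM2l// ltW.
  rewrite leNgt; apply/negP => abz.
  have bz : (1 - z + z ^+ 2 / 2 < b)%R by lra.
  have w0 : (0 < 1 + z + z ^+ 2 / 2)%R by have := sqr_ge0 z; lra.
  move: bz; rewrite -(ltr_pM2r w0) => /lt_le_trans /(_ bq).
  have -> : ((1 - z + z ^+ 2 / 2) * (1 + z + z ^+ 2 / 2)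
             = 1 + (z ^+ 2) ^+ 2 / 4)%R by field.
  have := sqr_ge0 (z ^+ 2); lra.
nra.
Qed.

(** Averaging the exponential moment bound at [t] and [-t] gives
[2 + t^2 E e^2 <= 2 exp(sigma2 t^2 / 2)], because [2 cosh y >= 2 + y^2]; a small
[t] then gives the constant [sigma2]. *)
Lemma noise_second_moment (sigma2 : R) (P : probability (measurableTypeR R) R) :
  (0 < sigma2)%R -> noise_class sigma2 P ->
  exists2 v : R, \int[P]_e ((e : R) ^+ 2)%:E = v%:E & (0 <= v <= sigma2)%R.
Proof.
move=> s0 [_ _ mgf]; set m := \int[P]_e _.
have m0 : 0 <= m by apply: integral_ge0 => x _; rewrite lee_fin sqr_ge0.
have mexp (t : R) : measurable_fun [set: measurableTypeR R]
    (fun e : measurableTypeR R => (expR ((e : R) * t))%:E).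
  apply/measurable_EFinP; apply: measurableT_comp => //.
  exact: measurable_funM.
have msq (c : R) : measurable_fun [set: measurableTypeR R]
    (fun e : measurableTypeR R => (c * (e : R) ^+ 2)%:E).
  by apply/measurable_EFinP/measurable_funM => //; exact: measurable_funX.
have key (t : R) : 2%:E + (t ^+ 2)%:E * m <= (2 * expR (sigma2 * t ^+ 2 / 2))%:E.
  have mgf' u : \int[P]_e (expR ((e : R) * u))%:E
      <= (expR (sigma2 * u ^+ 2 / 2))%:E.
    by have := mgf u; rewrite /mmt_gen_fun unlock.
  have -> : (2 * expR (sigma2 * t ^+ 2 / 2))%:E =
      (expR (sigma2 * t ^+ 2 / 2))%:E + (expR (sigma2 * (- t) ^+ 2 / 2))%:E.
    by rewrite sqrrN -EFinD; congr EFin; ring.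
  apply: le_trans (leeD (mgf' t) (mgf' (- t)%R)).
  rewrite -ge0_integralD//.
  have -> : 2%:E + (t ^+ 2)%:E * m
          = \int[P]_e (2%:E + (t ^+ 2 * (e : R) ^+ 2)%:E).
    rewrite ge0_integralD//; last first.
      by move=> x _; rewrite lee_fin mulr_ge0// sqr_ge0.
    rewrite integral_prob_cst; congr (_ + _).
    under [RHS]eq_integral do rewrite EFinM.
    rewrite ge0_integralZl//.
    - by apply/measurable_EFinP; exact: measurable_funX.
    - by move=> x _; rewrite lee_fin sqr_ge0.
    - by rewrite lee_fin sqr_ge0.
  apply: ge0_le_integral => //.
  - by move=> x _; rewrite adde_ge0// lee_fin// mulr_ge0// sqr_ge0.
  - exact: emeasurable_funD.
  - exact: emeasurable_funD.
  - move=> x _; rewrite -!EFinD lee_fin mulrN -exprMn mulrC.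
    exact: quad_le_cosh.
have mfin : m \is a fin_num.
  rewrite ge0_fin_numE//; have := key 1%R; rewrite expr1n mul1e.
  by case: (m) m0 => [r||]//= _; rewrite ltry.
exists (fine m); first by rewrite fineK.
rewrite fine_ge0//= leNgt; apply/negP => vs; move: key; rewrite -(fineK mfin).
set v := fine m in vs * => keyE.
have key t : (2 + t ^+ 2 * v <= 2 * expR (sigma2 * t ^+ 2 / 2))%R.
  by rewrite -lee_fin; exact: keyE.
have v0 : (0 < v)%R by exact: lt_trans vs.
(* with [u = sigma2 t^2 / 2], [exp u <= 1 / (1 - u)] turns the bound into
   [v (1 - u) <= sigma2], which this [u] violates *)
pose u := ((v - sigma2) / (2 * v))%R.
have u0 : (0 < u)%R by rewrite divr_gt0 ?mulr_gt0// subr_gt0.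
have u1 : (u < 1)%R by rewrite ltr_pdivrMr ?mulr_gt0//; lra.
have := key (Num.sqrt (2 * u / sigma2))%R.
rewrite sqr_sqrtr; last first.
  by apply: divr_ge0; [apply: mulr_ge0 => //|]; exact: ltW.
have -> : (sigma2 * (2 * u / sigma2) / 2 = u)%R by field; rewrite gt_eqF.
have : (expR u <= (1 - u)^-1)%R.
  rewrite -[leLHS]invrK -expRN lef_pV2 ?posrE ?expR_gt0 ?subr_gt0//.
  by have := expR_ge1Dx (- u)%R.
move=> eu ku.
have {eu ku} : (1 + u / sigma2 * v <= (1 - u)^-1)%R by rewrite mulrAC; lra.
rewrite -[leRHS]mul1r ler_pdivlMr ?subr_gt0// => H.
have : (v * (1 - u) <= sigma2)%R.
  have : (u * (v / sigma2 * (1 - u)) <= u * 1)%R by nra.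
  by rewrite ler_pM2l// mulrAC ler_pdivrMr// mul1r.
have -> : (v * (1 - u) = (v + sigma2) / 2)%R.
  by rewrite /u; field; rewrite gt_eqF.
lra.
Qed.

End moments.

(** * Risk of the clipped projection estimator *)

Lemma measurable_cube_fun (R : realType) s (h : cube s -> R) :
  measurable_fun [set: cube s] h.
Proof. by move=> ? ? ?; exact: cubeP. Qed.

Lemma integral_uniform_cube (R : realType) s (h : cube s -> R) :
  (\int[uniform_cube R s]_x (h x)%:E)%E
  = ((2 ^+ s)^-1 * \sum_(x : cube s) h x)%:E.
Proof. by rewrite -expectation_uniform_cube unlock. Qed.

Lemma clip01_contraction (R : realType) (t b : R) :
  0 <= b <= 1 -> (clip01 t - b) ^+ 2 <= (t - b) ^+ 2.
Proof.
move=> /andP[b0 b1]; rewrite /clip01.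
have [t1|t1] := leP t 1; last first.
  rewrite max_r//; rewrite -subr_ge0 subr_sqr mulr_ge0//; lra.
have [t0|t0] := leP 0 t; first by [].
rewrite -subr_ge0 -oppr_le0 opprB subr_sqr mulr_ge0_le0//; lra.
Qed.

Lemma nb_coeffsE s D : #|[set S : {set 'I_s} | (#|S| <= D)%N]%SET| = nb_coeffs s D.
Proof.
rewrite -sum1_card; under eq_bigl do rewrite finset.inE.
rewrite (partition_big (fun S : {set 'I_s} => inord #|S| : 'I_D.+1) predT)//=.
rewrite /nb_coeffs big_mkord; apply: eq_bigr => k _.
have -> : 'C(s, k) = 'C(#|'I_s|, k) by rewrite card_ord.
rewrite -card_draws -sum1_card.
apply: eq_bigl => S; rewrite finset.inE.
apply/andP/eqP => [[SD /eqP <-]|Sk]; first by rewrite inordK.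
by rewrite Sk -ltnS; split=> //; rewrite inord_val.
Qed.

Section upper.
Context (R : realType) (s n : nat).
Implicit Types (g : cube s -> R) (S : {set 'I_s}).

Local Notation pair := (cube s * measurableTypeR R)%type.
Local Notation sample := (n.-tuple pair).

Lemma measurable_design (h : cube s -> R) :
  measurable_fun [set: pair] (fun p => h p.1).
Proof. by apply: measurableT_comp => //; exact: measurable_cube_fun. Qed.

Lemma measurable_response : measurable_fun [set: pair] (fun p => p.2 : R).
Proof. exact: measurable_snd. Qed.

Lemma measurable_observe g : measurable_fun [set: sample] (observe g).
Proof.
apply/measurable_fun_tnthP => i.
rewrite (_ : _ \o _ = (fun p : pair => (p.1, g p.1 + p.2)) \o (@tnth n pair ^~ i)).
  apply: measurableT_comp; last exact: measurable_tnth.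
  apply: measurable_fun_pair => //.
  apply: measurable_funD; first exact: measurable_design.
  exact: measurable_response.
by apply/funext => w /=; rewrite tnth_mktuple.
Qed.

Lemma measurable_loss (gh : sample -> cube s -> R) g : estimator gh ->
  measurable_fun [set: sample]
    (fun w => sqnorm2 (fun x => gh (observe g w) x - g x)).
Proof.
move=> mgh; apply: measurable_funM => //; apply: measurable_sum => x.
apply: measurable_funX; apply: measurable_funB => //.
exact: (measurableT_comp (mgh x) (measurable_observe g)).
Qed.

Lemma sqnorm2_ge0 (h : cube s -> R) : 0 <= sqnorm2 h.
Proof.
by rewrite mulr_ge0 ?invr_ge0 ?exprn_ge0// sumr_ge0// => x _; exact: sqr_ge0.
Qed.

Lemma measurable_emp_fourier S :
  measurable_fun [set: sample] (fun z => emp_fourier z S).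
Proof.
apply: measurable_funM => //.
apply: (@measurable_sum_tnth R _ pair n (fun p => p.2 * walsh R S p.1)).
apply: measurable_funM; first exact: measurable_response.
exact: (measurable_design (walsh R S)).
Qed.

Lemma clipped_proj_estimator D : estimator (@clipped_proj R s n D).
Proof.
move=> x; apply: measurable_maxr => //; apply: measurable_minr => //.
rewrite (_ : fourier_proj _ ^~ _ = fun z => \sum_(S : {set 'I_s})
    if (#|S| <= D)%N then emp_fourier z S * walsh R S x else 0); last first.
  by apply/funext => z; rewrite /fourier_proj big_mkcond.
apply: measurable_sum => S; case: (#|S| <= D)%N => //.
by apply: measurable_funM => //; exact: measurable_emp_fourier.
Qed.

Definition coeff_error g S (p : pair) : R :=
  (g p.1 + p.2) * walsh R S p.1 - fourier g S.

Lemma measurable_coeff_error g S : measurable_fun [set: pair] (coeff_error g S).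
Proof.
apply: measurable_funB => //; apply: measurable_funM.
  apply: measurable_funD; first exact: measurable_design.
  exact: measurable_response.
exact: (measurable_design (walsh R S)).
Qed.

Lemma emp_fourier_error g S (w : sample) : (0 < n)%N ->
  emp_fourier (observe g w) S - fourier g S
  = n%:R^-1 * \sum_(j < n) coeff_error g S (tnth w j).
Proof.
move=> n0; rewrite /coeff_error big_split/= sumr_const card_ord mulrDr.
have nK (z : R) : n%:R^-1 * (z *+ n) = z.
  by rewrite -(mulr_natl z) mulrA mulVf ?mul1r// pnatr_eq0 -lt0n.
rewrite nK.
congr (_ * _ - _); apply: eq_bigr => j _.
by rewrite tnth_mktuple.
Qed.

Context (sigma2 : R) (P : probability (measurableTypeR R) R).
Hypotheses (s20 : 0 < sigma2) (hP : noise_class sigma2 P).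

(** The variance of [Y chi_S(X)] is at most its second moment
[E (g(X) + e)^2 = E g(X)^2 + E e^2]. *)
Lemma coeff_error_second_moment g S : (forall x, 0 <= g x <= 1) ->
  exists2 v : R,
    (\int[prod_law (uniform_cube R s) P]_p (coeff_error g S p ^+ 2)%:E = v%:E)%E
    & v <= sigma2 + 1.
Proof.
move=> g01; have [v hv /andP[v0 vs]] := noise_second_moment s20 hP.
have [_ P0 _] := hP; move: P0; rewrite unlock => P0.
exists ((2 ^+ s)^-1 *
    \sum_x ((g x * walsh R S x - fourier g S) ^+ 2 + walsh R S x ^+ 2 * v)).
  rewrite integral_prod_law//; first last.
  - by move=> p; rewrite lee_fin sqr_ge0.
  - apply/measurable_EFinP; apply: measurable_funX.
    exact: measurable_coeff_error.
  rewrite -integral_uniform_cube; apply: eq_integral => x _.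
  rewrite -(affine_second_moment _ _ _ P0 hv)//.
  apply: eq_integral => e _; congr ((_ ^+ 2)%:E).
  by rewrite /coeff_error/=; ring.
have cardE : \sum_(x : cube s) (1 : R) = 2 ^+ s.
  by rewrite sumr_const card_tuple card_bool natrX.
have -> : \sum_x ((g x * walsh R S x - fourier g S) ^+ 2 + walsh R S x ^+ 2 * v)
    = \sum_x g x ^+ 2 - 2 ^+ s * fourier g S ^+ 2 + 2 ^+ s * v.
  have -> : 2 ^+ s * fourier g S ^+ 2
      = 2 * fourier g S * (\sum_x g x * walsh R S x)
        - fourier g S ^+ 2 * \sum_(x : cube s) 1.
    rewrite cardE [in RHS](_ : \sum_x _ = 2 ^+ s * fourier g S); first by ring.
    by rewrite fourierE mulrA mulfV ?pow2s_neq0// mul1r.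
  rewrite -cardE mulr_suml !mulr_sumr -!sumrB -big_split/=.
  apply: eq_bigr => x _; have := walsh_sqr R S x; rewrite -expr2 => w2.
  rewrite sqrrB exprMn w2; ring.
have p0 : 0 < (2 ^+ s : R) by rewrite exprn_gt0.
rewrite mulrDr (mulrA _ _ v) mulVf ?pow2s_neq0// mul1r.
rewrite addrC lerD// ler_pdivrMl// mulr1.
rewrite lerBlDr; apply: ler_wpDr.
  by apply: mulr_ge0; [exact: ltW|exact: sqr_ge0].
rewrite -cardE.
by apply: ler_sum => x _; rewrite expr_le1//; have /andP[] := g01 x.
Qed.

Lemma coeff_error_mean g S : (forall x, 0 <= g x <= 1) ->
  (\int[prod_law (uniform_cube R s) P]_p (coeff_error g S p)%:E = 0)%E.
Proof.
move=> g01; have [v vE _] := coeff_error_second_moment S g01.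
have [ih _] := integrable_of_sqr (measurable_coeff_error g S) vE.
have [iP P0 _] := hP; move: P0; rewrite unlock => P0.
rewrite -(integral12_prod_meas1 ih).
transitivity (\int[uniform_cube R s]_x (g x * walsh R S x - fourier g S)%:E)%E.
  apply: eq_integral => x _; rewrite /fubini_F/=.
  transitivity (\int[P]_e ((g x * walsh R S x - fourier g S)%:E
      + (walsh R S x)%:E * (e : R)%:E))%E.
    by apply: eq_integral => e _; rewrite -EFinM -EFinD /coeff_error/=;
       congr EFin; ring.
  rewrite integralD//; last exact: integrableZl.
    by rewrite integral_prob_cst integralZl// P0 mule0 adde0.
  exact: (@finite_measure_integrable_cst _ _ _ P).
rewrite integral_uniform_cube sumrB mulrBr -fourierE sumr_const.
rewrite card_tuple card_bool -[X in _ - _ * X]mulr_natl natrX mulrA.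
by rewrite mulVf ?pow2s_neq0// mul1r subrr.
Qed.

(** Clipping can only help since [g] takes its values in [[0, 1]]; Parseval
then splits the loss into a stochastic error at the frequencies up to [D] and
the deterministic mass of [g] above [D]. *)
Lemma clipped_proj_loss_le g (B : R) D (w : sample) : (0 < n)%N ->
  mono_class B g ->
  sqnorm2 (fun x => clipped_proj D (observe g w) x - g x)
  <= \sum_(S : {set 'I_s} | (#|S| <= D)%N)
       (n%:R^-2 * (\sum_(j < n) coeff_error g S (tnth w j)) ^+ 2)
     + B / (4 * D.+1%:R).
Proof.
move=> n0 [g01 _ gB].
apply: (@le_trans _ _ (sqnorm2 (fun x => fourier_proj D (observe g w) x - g x))).
  rewrite ler_wpM2l ?invr_ge0 ?exprn_ge0// ler_sum// => x _.
  exact: clip01_contraction.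
pose c S := if (#|S| <= D)%N then emp_fourier (observe g w) S - fourier g S
            else - fourier g S.
rewrite [X in sqnorm2 X](_ : _ = fun x => \sum_S c S * walsh R S x); last first.
  apply/funext => x; rewrite [g x]fourier_inversion /fourier_proj big_mkcond/=.
  rewrite -sumrB; apply: eq_bigr => S _; rewrite /c; case: ifP => _.
    by rewrite mulrBl.
  by rewrite sub0r mulNr.
rewrite sqnorm2_walsh_sum (bigID (fun S : {set 'I_s} => (#|S| <= D)%N))/=.
apply: lerD.
  apply: ler_sum => S SD; rewrite /c SD emp_fourier_error// exprMn.
  by rewrite exprVn.
rewrite (eq_bigr (fun S => fourier g S ^+ 2)); first exact: fourier_tail_le.
by move=> S /negPf SD; rewrite /c SD sqrrN.
Qed.

Lemma clipped_proj_risk_le g (B : R) D : (0 < n)%N -> mono_class B g ->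
  (risk P (@clipped_proj R s n D) g
   <= ((sigma2 + 1) * (nb_coeffs s D)%:R / n%:R + B / (4 * D.+1%:R))%:E)%E.
Proof.
move=> n0 gB; have [g01 _ gE] := gB.
have nR0 : 0 < n%:R :> R by rewrite ltr0n.
pose E S (w : sample) := n%:R^-2 * (\sum_(j < n) coeff_error g S (tnth w j)) ^+ 2.
have E0 S w : 0 <= E S w by rewrite mulr_ge0 ?sqr_ge0 ?invr_ge0 ?exprn_ge0.
have mE S : measurable_fun [set: sample] (E S).
  apply: measurable_funM => //; apply: measurable_funX.
  by apply: measurable_sum_tnth; exact: measurable_coeff_error.
have tail0 : 0 <= B / (4 * D.+1%:R).
  apply: le_trans (fourier_tail_le D gE).
  by apply: sumr_ge0 => S _; exact: sqr_ge0.
rewrite /risk unlock.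
apply: (@le_trans _ _ (\int[design_noise_law s n P]_w
  ((\sum_(S <- enum [set S : {set 'I_s} | (#|S| <= D)%N]%SET) (E S w)%:E)%E
   + (B / (4 * D.+1%:R))%:E)%E)%E).
  apply: ge0_le_integral => //.
  - by move=> w _; rewrite lee_fin sqnorm2_ge0.
  - apply/measurable_EFinP; apply: measurable_loss.
    exact: clipped_proj_estimator.
  - apply: emeasurable_funD => //; apply: emeasurable_sum => S.
    exact/measurable_EFinP.
  - move=> w _; rewrite sumEFin -EFinD lee_fin big_enum_cond/=.
    rewrite (eq_bigl (fun S : {set 'I_s} => (#|S| <= D)%N)).
      exact: clipped_proj_loss_le n0 gB.
    by move=> S; rewrite ?andbT ?finset.inE.
rewrite ge0_integralD//; first last.
- by apply: emeasurable_sum => S; exact/measurable_EFinP.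
- by move=> w _; apply: sume_ge0 => S _; rewrite lee_fin.
rewrite ge0_integral_sum//; first last.
- by move=> S w _; rewrite lee_fin.
- by move=> S; exact/measurable_EFinP.
rewrite integral_prob_cst EFinD leeD2r//.
apply: (@le_trans _ _ (\sum_(S <- enum [set S : {set 'I_s} | (#|S| <= D)%N]%SET)
   ((sigma2 + 1) / n%:R)%:E)%E).
  apply: lee_sum => S _; rewrite /E.
  have [v vE vle] := coeff_error_second_moment S g01.
  under eq_integral do rewrite EFinM.
  rewrite ge0_integralZl//; first last.
  - by move=> w _; rewrite lee_fin sqr_ge0.
  - apply/measurable_EFinP; apply: measurable_funX.
    by apply: measurable_sum_tnth; exact: measurable_coeff_error.
  rewrite (iid_sum_second_moment _ (measurable_coeff_error g S) _ vE).
    rewrite -EFinM lee_fin.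
    have -> : n%:R ^- 2 * (n%:R * v) = v / n%:R by field; rewrite gt_eqF.
    by rewrite ler_wpM2r// invr_ge0 ltW.
  exact: coeff_error_mean.
rewrite sumEFin lee_fin big_enum/= sumr_const nb_coeffsE -[leLHS]mulr_natr.
by rewrite mulrAC.
Qed.

End upper.

(** * Lower bound by free values on the middle layer *)

Section central_binomial.

Lemma binS_central k : ('C(k.+1.*2, k.+1) * k.+1 = 2 * (k.*2.+1 * 'C(k.*2, k)))%N.
Proof.
rewrite mulnC -mul_bin_diag doubleS /=.
have -> : 'C(k.*2.+1, k) = 'C(k.*2.+1, k.+1).
  rewrite -bin_sub; last by rewrite -addnn; lia.
  by congr 'C(_, _); rewrite -addnn; lia.
have /= := mul_bin_diag k.*2.+1 k.
have : k.*2.+2 = (2 * k.+1)%N by rewrite -addnn; lia.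
by move=> ->; nia.
Qed.

(** This is [C(2k, k) >= 4^k / (2 sqrt k)], squared to stay among integers. *)
Lemma central_binomial_ge k : (0 < k)%N -> (16 ^ k <= 4 * k * 'C(k.*2, k) ^ 2)%N.
Proof.
elim: k => // -[_ _|k IH _]; first by [].
have {}IH := IH isT; have := binS_central k.+1.
set C := 'C(k.+1.*2, k.+1) in IH *; set C' := 'C(_, _) => CC'.
rewrite -(leq_pmul2r (ltn0Sn k.+1)).
have -> : (4 * k.+2 * C' ^ 2 * k.+2 = 4 * (C' * k.+2) ^ 2)%N.
  by rewrite expnMn; ring.
rewrite CC' !expnMn expnS; move: IH; rewrite -addnn; nia.
Qed.

Lemma middle_binomial_ge (R : realType) (B : R) s :
  0 < B -> (1 < s)%N -> 2 * B ^+ 2 <= s%:R ->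
  B * 2 ^+ s <= 2 * s%:R * 'C(s, s./2)%:R.
Proof.
move=> B0 s1 Bs; set k := s./2.
have sE : (s = odd s + k.*2)%N by rewrite odd_double_half.
have k0 : (0 < k)%N by rewrite half_gt0.
have Ck : ('C(k.*2, k) <= 'C(s, k))%N.
  by apply: leq_bin2l; rewrite [leqRHS]sE leq_addl.
have pow : (2 ^ s * 2 ^ s <= 4 * 16 ^ k)%N.
  have -> : (16 ^ k = 2 ^ k * 2 ^ k * (2 ^ k * 2 ^ k))%N by rewrite -!expnMn.
  rewrite [X in (2 ^ X)%N]sE expnD -addnn expnD; set e := (2 ^ k)%N.
  by case: (odd s); rewrite ?expn1 ?expn0; nia.
have := central_binomial_ge k0; set C := 'C(k.*2, k) in Ck * => C16.
have {}pow : (2 ^+ s) ^+ 2 <= 16 * k%:R * C%:R ^+ 2 :> R.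
  rewrite expr2 -!natrX -!natrM ler_nat.
  rewrite (leq_trans pow)// (@leq_trans (4 * (4 * k * C ^ 2)))//.
    by rewrite leq_mul2l.
  by rewrite !mulnA.
have ks : 2 * k%:R <= s%:R :> R.
  by rewrite -natrM ler_nat [X in (_ <= X)%N]sE -addnn; lia.
have {}Ck : C%:R <= 'C(s, k)%:R :> R by rewrite ler_nat.
have s0 : 0 < s%:R :> R by rewrite ltr0n ltnW.
apply: (@le_trans _ _ (2 * s%:R * C%:R)); last by rewrite ler_wpM2l// mulr_ge0.
rewrite -(@ler_pXn2r _ 2)// ?nnegrE ?mulr_ge0 ?exprn_ge0 ?(ltW B0)//.
rewrite !exprMn.
apply: (@le_trans _ _ (B ^+ 2 * (16 * k%:R * C%:R ^+ 2))).
  by rewrite ler_wpM2l ?sqr_ge0// -!exprMn.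
rewrite mulrA ler_wpM2r ?sqr_ge0//.
nra.
Qed.

End central_binomial.

Section layers.
Context (s : nat).
Implicit Types (x : cube s) (i : 'I_s).

Definition weight x : nat := (\sum_(i < s) tnth x i)%N.

Lemma weight_set_coord x i a :
  weight (set_coord x i a) = (a + \sum_(j < s | j != i) tnth x j)%N.
Proof.
rewrite /weight (bigD1 i)//= tnth_set_coord eqxx; congr (_ + _)%N.
by apply: eq_bigr => j /negPf ji; rewrite tnth_set_coord ji.
Qed.

Lemma weight_flip x i :
  weight (flip x i) = (weight x).+1 \/ weight x = (weight (flip x i)).+1.
Proof.
have -> : weight x = (tnth x i + \sum_(j < s | j != i) tnth x j)%N.
  by rewrite /weight (bigD1 i).
rewrite weight_set_coord.
by case: (tnth x i); [right|left]; rewrite !add0n !add1n.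
Qed.

Definition layer m : {set cube s} := [set x | weight x == m]%SET.

Lemma card_layer_ge m : ('C(s, m) <= #|layer m|)%N.
Proof.
have -> : 'C(s, m) = 'C(#|'I_s|, m) by rewrite card_ord.
rewrite -card_draws.
pose f (A : {set 'I_s}) : cube s := [tuple i \in A | i < s].
have f_inj : injective f.
  move=> A A' /(congr1 (fun x => tnth x)) AA'; apply/setP => i.
  by have := congr1 (fun h => h i) AA'; rewrite !tnth_mktuple.
rewrite -(card_imset _ f_inj); apply: subset_leq_card.
apply/fintype.subsetP => x.
case/imsetP => A; rewrite !finset.inE => /eqP Am ->; rewrite /weight -Am.
rewrite -sum1_card [in X in _ == X]big_mkcond/=; apply/eqP/eq_bigr => i _.
by rewrite tnth_mktuple; case: ifP.
Qed.

End layers.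

Section hard_family.
Context (R : realType) (s m : nat) (a : R).
Implicit Types (x : cube s) (U : {set cube s}).

(** Monotone for every [U]: the values on the layer of weight [m] are free
between the constant values below and above it. *)
Definition step_fun U x : R :=
  if (weight x < m)%N then 0
  else if weight x == m then (if x \in U then a else 0) else a.

Hypothesis a0 : 0 <= a.

Lemma step_fun_ge0 U x : 0 <= step_fun U x.
Proof. by rewrite /step_fun; do 3 case: ifP => _ //. Qed.

Lemma step_fun_le U x : step_fun U x <= a.
Proof. by rewrite /step_fun; do 3 case: ifP => _ //. Qed.

Lemma step_fun_nondecreasing U : coord_nondecreasing (step_fun U).
Proof.
move=> i x.
have wE : weight (set_coord x i true) = (weight (set_coord x i false)).+1.
  by rewrite !weight_set_coord.
have [lt_m|le_m] := ltnP (weight (set_coord x i false)) m.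
  by rewrite {1}/step_fun lt_m step_fun_ge0.
rewrite (le_trans (step_fun_le _ _))// /step_fun wE ltnNge (leq_trans le_m)//=.
by rewrite gtn_eqF.
Qed.

(** A flip changes the value only if one of the two endpoints lies on the
layer. *)
Lemma step_fun_flip_sqr_le U x i :
  (step_fun U x - step_fun U (flip x i)) ^+ 2
  <= a ^+ 2 * (x \in layer s m)%:R + a ^+ 2 * (flip x i \in layer s m)%:R.
Proof.
have a20 : 0 <= a ^+ 2 by exact: sqr_ge0.
have diff_le : (step_fun U x - step_fun U (flip x i)) ^+ 2 <= a ^+ 2.
  have := step_fun_le U x; have := step_fun_le U (flip x i).
  have := step_fun_ge0 U x; have := step_fun_ge0 U (flip x i); nra.
rewrite !finset.inE.
have [_|xm] := eqVneq (weight x) m.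
  by rewrite mulr1 (le_trans diff_le)// lerDl mulr_ge0.
have [_|fm] := eqVneq (weight (flip x i)) m.
  by rewrite mulr1 mulr0 add0r.
rewrite !mulr0 addr0 /step_fun (negPf xm) (negPf fm).
have -> : (weight (flip x i) < m)%N = (weight x < m)%N.
  by move: xm fm; case: (weight_flip x i) => ->; lia.
by rewrite subrr expr0n.
Qed.

Lemma step_fun_energy_le U :
  sobolev_energy (step_fun U) <= 2 * a ^+ 2 * s%:R * #|layer s m|%:R / 2 ^+ s.
Proof.
have layerE : \sum_(x : cube s) (x \in layer s m)%:R = #|layer s m|%:R :> R.
  by rewrite -sum1_card natr_sum [RHS]big_mkcond; apply: eq_bigr => x _; case: ifP.
rewrite sobolev_energyE.
apply: (@le_trans _ _ (\sum_(i < s) ((2 ^+ s)^-1 * (2 * a ^+ 2 * #|layer s m|%:R)))).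
  apply: ler_sum => i _; rewrite ler_wpM2l ?invr_ge0 ?exprn_ge0//.
  apply: le_trans (ler_sum _ (fun x _ => step_fun_flip_sqr_le U x i)) _.
  rewrite big_split/= -!mulr_sumr (sum_flip i (fun x => (x \in layer s m)%:R)).
  by rewrite layerE -mulrDl -mulr2n mulr_natl.
rewrite sumr_const card_ord -[leLHS]mulr_natl.
by rewrite le_eqVlt; apply/orP; left; apply/eqP; ring.
Qed.

End hard_family.

Section noiseless.
Context (R : realType).

(** Responses without noise already leave the unobserved values undetermined,
and the Dirac mass at [0] lies in the class for every [sigma2]. *)
Lemma dirac_noise_class (sigma2 : R) : 0 <= sigma2 ->
  noise_class sigma2 (\d_(0 : measurableTypeR R)).
Proof.
move=> s0; split.
- apply/integrableP; split; first exact/measurable_EFinP.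
  rewrite integral_dirac//; last by apply: measurableT_comp.
  by rewrite diracT mul1e/= normr0 ltry.
- by rewrite unlock integral_dirac ?diracT ?mul1e//; exact/measurable_EFinP.
- move=> t; rewrite /mmt_gen_fun unlock integral_dirac ?diracT ?mul1e//=.
    rewrite mul0r expR0 lee_fin -expR0 ler_expR.
    by rewrite divr_ge0// mulr_ge0// sqr_ge0.
  apply/measurable_EFinP; apply: measurableT_comp => //.
  exact: measurable_funM.
Qed.

End noiseless.

Section unobserved.
Context (R : realType) (s n : nat).
Local Notation pair := (cube s * measurableTypeR R)%type.
Local Notation sample := (n.-tuple pair).
Implicit Types (x : cube s) (w : sample).

Definition unobserved x : set sample :=
  [set w | forall j, [set p : pair | p.1 != x] (tnth w j)].

Let measurable_avoid x : measurable [set p : pair | p.1 != x].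
Proof.
rewrite (_ : [set _ | _] = [set y | y != x] `*` [set: measurableTypeR R]).
  by apply: measurableX => //; exact: cubeP.
by apply/seteqP; split=> [p|p []]//.
Qed.

Lemma measurable_unobserved x : measurable (unobserved x).
Proof. by apply: (@measurable_box _ _ n (fun=> [set p : pair | p.1 != x])). Qed.

Let avoid_probability x (P : probability (measurableTypeR R) R) :
  prod_law (uniform_cube R s) P [set p : pair | p.1 != x]
  = (1 - (2 ^+ s)^-1)%:E.
Proof.
rewrite (_ : [set _ | _] = [set y | y != x] `*` [set: measurableTypeR R]); last first.
  by apply/seteqP; split=> [p|p []]//.
rewrite /prod_law product_measure1E//=; last exact: cubeP.
transitivity (uniform_cube R s [set y | y != x] * 1)%E.
  by congr (_ * _)%E; exact: probability_setT.
rewrite mule1.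
transitivity (\int[uniform_cube R s]_y (\1_[set y | y != x] y)%:E)%E.
  by rewrite integral_indic ?setIT//; exact: cubeP.
rewrite integral_uniform_cube.
have -> : \sum_(y : cube s) \1_[set y | y != x] y
          = \sum_(y : cube s) (1 - (y == x)%:R) :> R.
  apply: eq_bigr => y _; rewrite indicE; case: eqVneq => [->|yx].
    by rewrite memNset//= ?eqxx// subrr.
  by rewrite mem_set//= subr0.
rewrite sumrB sumr_const card_tuple card_bool natrX.
rewrite (bigD1 x)//= eqxx big1 ?addr0; last by move=> y /negPf ->.
by rewrite mulrBr mulr1 mulVf// pow2s_neq0.
Qed.

Lemma unobserved_probability x (P : probability (measurableTypeR R) R) :
  design_noise_law s n P (unobserved x) = ((1 - (2 ^+ s)^-1) ^+ n)%:E.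
Proof.
rewrite /design_noise_law /unobserved.
rewrite (@iid_law_box _ _ _ _ n (fun=> [set p : pair | p.1 != x]))//.
rewrite (eq_bigr (fun=> (1 - (2 ^+ s)^-1)%:E)); last first.
  by move=> j _; exact: avoid_probability.
by rewrite prodEFin prodr_const card_ord.
Qed.

End unobserved.

Lemma bernoulli_inequality (R : realDomainType) (t : R) n :
  0 <= t <= 1 -> 1 - n%:R * t <= (1 - t) ^+ n.
Proof.
move=> /andP[t0 t1]; elim: n => [|n IH]; first by rewrite mul0r subr0.
rewrite exprS (le_trans _ (ler_wpM2l _ IH)) ?subr_ge0//.
rewrite -[n.+1]addn1 natrD; have : 0 <= n%:R * t * t by rewrite !mulr_ge0.
lra.
Qed.

Section lower.
Context (R : realType) (s n m : nat) (a : R).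
Hypothesis a0 : 0 <= a.
Local Notation pair := (cube s * measurableTypeR R)%type.
Local Notation sample := (n.-tuple pair).
Implicit Types (x : cube s) (w : sample) (U : {set cube s}).

Definition toggle x U : {set cube s} :=
  if x \in U then (U :\ x)%SET else (x |: U)%SET.

Lemma in_toggle x U y : (y \in toggle x U) = (if y == x then x \notin U else y \in U).
Proof.
by rewrite /toggle; case: ifP => xU; rewrite !finset.inE; case: eqVneq => // ->.
Qed.

Lemma toggleK x : involutive (toggle x).
Proof.
move=> U; apply/setP => y; rewrite !in_toggle eqxx.
by case: eqVneq => // ->; rewrite negbK.
Qed.

Lemma observe_toggle x U w : unobserved x w ->
  observe (step_fun m a (toggle x U)) w = observe (step_fun m a U) w.
Proof.
move=> wx; apply: eq_from_tnth => j; rewrite !tnth_mktuple.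
by rewrite /step_fun in_toggle (negPf (wx j)).
Qed.

(** [U] and [toggle x U] give the same data but targets [a] apart at [x], so
one prediction pays at least [a^2 / 2] over the two. *)
Lemma sum_loss_unobserved (gh : sample -> cube s -> R) x w :
  x \in layer s m -> unobserved x w ->
  #|{set cube s}|%:R * (a ^+ 2 / 4)
  <= \sum_U (gh (observe (step_fun m a U) w) x - step_fun m a U x) ^+ 2.
Proof.
rewrite finset.inE => /eqP xm wx.
pose F U := (gh (observe (step_fun m a U) w) x - step_fun m a U x) ^+ 2.
have FD U : a ^+ 2 / 2 <= F U + F (toggle x U).
  rewrite /F observe_toggle// /step_fun in_toggle eqxx xm ltnn eqxx.
  set t := gh _ _.
  have := sqr_ge0 (t + (t - a)); case: (x \in U); rewrite /= subr0; lra.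
have : \sum_(U : {set cube s}) (a ^+ 2 / 2)
    <= \sum_(U : {set cube s}) (F U + F (toggle x U)).
  by apply: ler_sum => U _.
have FE : \sum_U F (toggle x U) = \sum_U F U.
  by rewrite [RHS](reindex_inj (inv_inj (toggleK x))).
rewrite big_split/= FE.
rewrite sumr_const -[X in X <= _]mulr_natl /F; lra.
Qed.

Lemma sum_loss_ge (gh : sample -> cube s -> R) w :
  #|{set cube s}|%:R * (a ^+ 2 / 4 / 2 ^+ s)
    * \sum_(x in layer s m) \1_(unobserved x) w
  <= \sum_U sqnorm2 (fun x => gh (observe (step_fun m a U) w) x - step_fun m a U x).
Proof.
rewrite /sqnorm2 -mulr_sumr exchange_big/= mulrA [leLHS]mulrAC [leLHS]mulrC.
rewrite ler_wpM2l ?invr_ge0 ?exprn_ge0//.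
rewrite mulr_sumr big_mkcond/=; apply: ler_sum => x _.
have S0 : 0 <= \sum_U (gh (observe (step_fun m a U) w) x - step_fun m a U x) ^+ 2.
  by apply: sumr_ge0 => U _; exact: sqr_ge0.
case: ifPn => // xm; rewrite indicE; case: (boolP (w \in unobserved x)) => wx.
  by rewrite mulr1; apply: sum_loss_unobserved => //; rewrite inE in wx.
by rewrite mulr0.
Qed.

(** The worst risk dominates the average of the risks over the family, and for
every sample that average is bounded below by the number of unobserved points of
the layer; only then is the sample integrated out. *)
Lemma minimax_risk_ge (sigma2 B : R) :
  0 <= sigma2 -> (forall U, mono_class B (step_fun m a U)) ->
  (n * 2 <= 2 ^ s)%N ->
  ((a ^+ 2 / 8 * (#|layer s m|%:R / 2 ^+ s))%:E
     <= minimax_risk n sigma2 (@mono_class R s B))%E.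
Proof.
move=> s20 hU n2s; apply/ereal_infP => _ [gh mgh <-].
set W := worst_risk _ _ _.
pose P : probability (measurableTypeR R) R := \d_(0 : measurableTypeR R).
have riskW U : (risk P gh (step_fun m a U) <= W)%E.
  apply: le_ereal_sup_tmp; exists (ereal_sup
    [set risk Q gh (step_fun m a U) | Q in noise_class sigma2]).
    by exists (step_fun m a U); [exact: hU|].
  apply: le_ereal_sup_tmp; exists (risk P gh (step_fun m a U)) => //.
  by exists P => //; exact: dirac_noise_class.
pose N : R := #|{set cube s}|%:R.
have N0 : 0 < N by rewrite ltr0n; apply/card_gt0P; exists finset.set0.
pose K := N * (a ^+ 2 / 4 / 2 ^+ s).
have K0 : 0 <= K.
  by apply: mulr_ge0; [exact: ltW|rewrite !divr_ge0 ?sqr_ge0 ?exprn_ge0].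
have mind x : measurable_fun [set: sample] (fun w => (\1_(unobserved x) w : R)%:E).
  by apply/measurable_EFinP; apply: measurable_indic;
     exact: measurable_unobserved.
have sumW : (\sum_(U : {set cube s}) risk P gh (step_fun m a U) <= N%:E * W)%E.
  apply: (@le_trans _ _ (\sum_(U : {set cube s}) W)%E); first exact: lee_sum.
  by rewrite sumr_const mule_natl.
have sum_ge : (K%:E * \sum_(x in layer s m) ((1 - (2 ^+ s)^-1) ^+ n)%:E
    <= \sum_(U : {set cube s}) risk P gh (step_fun m a U))%E.
  under [leRHS]eq_bigr do rewrite /risk unlock.
  rewrite -ge0_integral_sum//; first last.
  - by move=> U w _; rewrite lee_fin sqnorm2_ge0.
  - by move=> U; apply/measurable_EFinP; exact: measurable_loss.
  have -> : (\sum_(x in layer s m) ((1 - (2 ^+ s)^-1) ^+ n)%:E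
     = \int[design_noise_law s n P]_w
        \sum_(x <- enum (layer s m)) (\1_(unobserved x) w)%:E)%E.
    rewrite ge0_integral_sum// big_enum/=; apply: eq_bigr => x _.
    rewrite integral_indic ?setIT//; last exact: measurable_unobserved.
    exact/esym/unobserved_probability.
  rewrite -ge0_integralZl//; first last.
  - by move=> w _; apply: sume_ge0 => x _; rewrite lee_fin.
  - exact: emeasurable_sum.
  apply: ge0_le_integral => //.
  - by move=> w _; rewrite mule_ge0// sume_ge0// => x _; rewrite lee_fin.
  - by apply: measurable_funeM; exact: emeasurable_sum.
  - by apply: emeasurable_sum => U; apply/measurable_EFinP; exact: measurable_loss.
  - by move=> w _; rewrite !sumEFin -EFinM lee_fin big_enum/=; exact: sum_loss_ge.
have := le_trans sum_ge sumW.
have half : 1 / 2 <= (1 - (2 ^+ s)^-1) ^+ n :> R.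
  have p0 : 0 < 2 ^+ s :> R by rewrite exprn_gt0.
  have p1 : 1 <= 2 ^+ s :> R by rewrite exprn_ege1// ler1n.
  apply: le_trans (bernoulli_inequality _ _); last first.
    by rewrite invr_ge0 ltW//= invf_le1.
  have : n%:R / 2 ^+ s <= 1 / 2 :> R.
    rewrite ler_pdivrMr// mulrAC ler_pdivlMr// mul1r -natrM -natrX.
    by rewrite ler_nat.
  lra.
rewrite sumEFin sumr_const -EFinM; case: W {riskW sumW} => [r||].
- rewrite -EFinM !lee_fin => H; rewrite -(ler_pM2l N0); apply: le_trans H.
  rewrite /K -[X in _ <= _ * X]mulr_natl.
  have -> : N * (a ^+ 2 / 8 * (#|layer s m|%:R / 2 ^+ s))
    = N * (a ^+ 2 / 4 / 2 ^+ s) * (#|layer s m|%:R * (1 / 2)).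
    by field; rewrite pow2s_neq0.
  by rewrite ler_wpM2l// ler_wpM2l.
- by move=> _; rewrite leey.
- by rewrite gt0_muleNy ?lte_fin.
Qed.

End lower.

(** The amplitude [a] is the largest one that the energy budget allows; the
number of points of the layer then cancels from the bound. It is at most [1]
once [s >= 2 B^2] because the middle layer carries a fraction of order
[s^(-1/2)] of the cube. *)
Lemma minimax_risk_mono_class_ge (R : realType) (B sigma2 : R) s n :
  0 < B -> 0 <= sigma2 -> (1 < s)%N -> 2 * B ^+ 2 <= s%:R -> (n * 2 <= 2 ^ s)%N ->
  ((1 / 16 * (B / s%:R))%:E <= minimax_risk n sigma2 (@mono_class R s B))%E.
Proof.
move=> B0 s20 s1 Bs n2s; pose m := s./2.
pose M : R := #|layer s m|%:R.
have Clayer : 'C(s, m)%:R <= M by rewrite ler_nat card_layer_ge.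
have M0 : 0 < M.
  apply: lt_le_trans Clayer; rewrite ltr0n bin_gt0 /m.
  by rewrite -{2}(odd_double_half s) -addnn; lia.
have s0 : 0 < s%:R :> R by rewrite ltr0n ltnW.
have p0 : 0 < 2 ^+ s :> R by rewrite exprn_gt0.
pose a : R := Num.sqrt (B * 2 ^+ s / (2 * s%:R * M)).
have a0 : 0 <= a by exact: sqrtr_ge0.
have a2 : a ^+ 2 = B * 2 ^+ s / (2 * s%:R * M).
  by rewrite sqr_sqrtr// divr_ge0 ?mulr_ge0 ?ltW.
have a1 : a <= 1.
  rewrite -(@ler_pXn2r _ 2)// ?nnegrE// expr1n a2 ler_pdivrMr ?mulr_gt0// mul1r.
  apply: le_trans (middle_binomial_ge B0 s1 Bs) _.
  by rewrite ler_pM2l ?mulr_gt0.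
have -> : 1 / 16 * (B / s%:R) = a ^+ 2 / 8 * (M / 2 ^+ s).
  by rewrite a2; field; rewrite !gt_eqF.
apply: minimax_risk_ge => // U; split.
- by move=> x; rewrite step_fun_ge0// (le_trans (step_fun_le m a0 U x)).
- exact: step_fun_nondecreasing.
- apply: le_trans (step_fun_energy_le _ a0 U) _; rewrite -/M a2.
  by rewrite le_eqVlt; apply/orP; left; apply/eqP; field; rewrite !gt_eqF.
Qed.

(** * Truncation degrees *)

(** Chernoff's bound for the lower tail of the binomial coefficients. *)
Lemma nb_coeffs_le (R : realFieldType) (x : R) s D : 0 < x <= 1 -> (D <= s)%N ->
  (nb_coeffs s D)%:R * x ^+ D <= (1 + x) ^+ s.
Proof.
move=> /andP[x0 x1] Ds.
have -> : (1 + x) ^+ s = \sum_(0 <= i < s.+1) 1 ^+ (s - i) * x ^+ i *+ 'C(s, i).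
  by rewrite exprDn big_mkord.
rewrite /nb_coeffs natr_sum mulr_suml.
rewrite [leRHS](@big_cat_nat _ _ _ D.+1)//= ler_wpDr//.
  by apply: sumr_ge0 => i _; rewrite mulrn_wge0// expr1n mul1r exprn_ge0// ltW.
rewrite !big_nat; apply: ler_sum => i; rewrite ltnS => /andP[_ iD].
rewrite expr1n mul1r -[leRHS]mulr_natl ler_wpM2l//.
by apply: ler_wiXn2l => //; exact: ltW.
Qed.

Section cutoffs.
Context (R : realType) (s n : nat) (B V : R).

Lemma resolvable_degree_ge D : (D <= s)%N -> (nb_coeffs s D <= n)%N ->
  (D <= resolvable_degree s n)%N.
Proof.
move=> Ds ND; have Ds1 : (D < s.+1)%N by [].
exact: (@leq_bigmax_cond _ (fun i : 'I_s.+1 => nb_coeffs s i <= n)%N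
  (fun i => nat_of_ord i) (Ordinal Ds1)).
Qed.

Lemma resolvable_degree_le : (resolvable_degree s n <= s)%N.
Proof. by apply/bigmax_leqP => i _; rewrite -ltnS. Qed.

Lemma balanced_cutoff_ge D : (D <= resolvable_degree s n)%N ->
  balanced s n B V D -> (D <= balanced_cutoff s n B V)%N.
Proof.
rewrite -ltnS => DD bD.
exact: (@leq_bigmax_cond _ (fun i : 'I__ => balanced s n B V i)
  (fun i => nat_of_ord i) (Ordinal DD)).
Qed.

Lemma balanced_balanced_cutoff D : (D <= resolvable_degree s n)%N ->
  balanced s n B V D -> balanced s n B V (balanced_cutoff s n B V).
Proof.
rewrite -ltnS => DD bD.
have [|i] := @eq_bigmax_cond _ [pred i : 'I__ | balanced s n B V i]
  (fun i : 'I_(resolvable_degree s n).+1 => nat_of_ord i).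
  by apply/card_gt0P; exists (Ordinal DD).
by rewrite inE => bi; rewrite /balanced_cutoff => ->.
Qed.

End cutoffs.

(** Both the resolvable degree and the balanced cutoff are maxima, so a single
positive degree [D >= delta s - 1] that is resolvable and balanced forces them
to be of order [s]. *)
Lemma worst_risk_clipped_le (R : realType) (B sigma2 delta : R) s n D :
  0 < B -> 0 < sigma2 -> 0 < delta -> (0 < s)%N -> (0 < n)%N ->
  (0 < D <= resolvable_degree s n)%N -> delta * s%:R <= D.+1%:R ->
  balanced s n B (sigma2 + 1) D ->
  (worst_risk sigma2 (@mono_class R s B)
     (@clipped_proj R s n (balanced_cutoff s n B (sigma2 + 1)))
   <= (delta^-1 * (B / s%:R))%:E)%E.
Proof.
move=> B0 s20 d0 s0 n0 /andP[D0 DD] Dd bD.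
apply/ereal_supP => _ [g gB <-]; apply/ereal_supP => _ [P hP <-].
apply: le_trans (clipped_proj_risk_le s20 hP _ n0 gB) _; rewrite lee_fin.
set Dsh := balanced_cutoff _ _ _ _.
have DDsh : (D <= Dsh)%N by exact: balanced_cutoff_ge.
have bDsh : balanced s n B (sigma2 + 1) Dsh by exact: balanced_balanced_cutoff bD.
have sR : 0 < s%:R :> R by rewrite ltr0n.
have ds0 : 0 < delta * s%:R by rewrite mulr_gt0.
set Dst := resolvable_degree s n in DD.
have Dst_ge : delta * s%:R / 2 <= Dst%:R.
  rewrite ler_pdivrMr// (le_trans Dd)// -natrM ler_nat; lia.
have Dsh_ge : delta * s%:R <= Dsh.+1%:R.
  by rewrite (le_trans Dd)// ler_nat.
apply: (@le_trans _ _ (B / (4 * (delta * s%:R / 2)) + B / (4 * (delta * s%:R)))).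
  apply: lerD; last first.
    by rewrite ler_pM2l// lef_pV2 ?posrE ?mulr_gt0 ?ltr0n// ler_pM2l.
  apply: le_trans bDsh _; rewrite ler_pM2l// lef_pV2 ?posrE ?mulr_gt0 ?ltr0n//.
    by rewrite ler_pM2l.
  by rewrite (leq_trans D0).
have -> : B / (4 * (delta * s%:R / 2)) + B / (4 * (delta * s%:R))
   = 3 / 4 * (delta^-1 * (B / s%:R)) by field; rewrite !gt_eqF.
have : 0 <= delta^-1 * (B / s%:R) by rewrite !mulr_ge0 ?invr_ge0 ?ltW.
lra.
Qed.

(** * Choice of the constants *)

Section constants.
Context (R : realType).

Lemma ln2_gt0 : 0 < ln 2 :> R.
Proof. by apply: ln_gt0; rewrite ltr1n. Qed.

Lemma ln2_le1 : ln 2 <= 1 :> R.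
Proof.
rewrite -ler_expR lnK ?posrE ?ltr0n//.
by have := expR_ge1Dx (1 : R); lra.
Qed.

(** With [x = ln 2 / (4 K)], both [(1 + x)^s] and [x^(- delta s)] are at most
[2^(s / (4 K)) <= n^(1/4)]. *)
Lemma nb_coeffs_sqr_le (K : R) : 1 <= K ->
  exists2 delta : R, 0 < delta <= 1 & forall s n D : nat,
    (0 < n)%N -> s%:R <= K * log2 n%:R -> D%:R <= delta * s%:R ->
    (nb_coeffs s D)%:R ^+ 2 <= n%:R :> R.
Proof.
move=> K1; have K0 : 0 < K by exact: lt_le_trans K1.
have l0 := ln2_gt0; have l1 := ln2_le1.
pose x : R := ln 2 / (4 * K).
have x0 : 0 < x by rewrite divr_gt0// mulr_gt0.
have x1 : x <= 1 by rewrite ler_pdivrMr ?mulr_gt0//; lra.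
have xK : 4 * x * K = ln 2 by rewrite /x; field; rewrite gt_eqF.
pose L : R := - ln x.
have L0 : 0 <= L by rewrite oppr_ge0 -ler_expR lnK ?posrE// expR0.
have L1 : 0 < L + 1 by rewrite ltr_wpDl.
exists (x / (L + 1)).
  by rewrite divr_gt0//= ler_pdivrMr// mul1r (le_trans x1)// lerDr.
move=> s n D n0 sn Dd.
have s0 : 0 <= s%:R :> R by [].
have nR : 0 < n%:R :> R by rewrite ltr0n.
have DL : D%:R * (L + 1) <= s%:R * x.
  rewrite -ler_pdivlMr//.
  by have -> : s%:R * x / (L + 1) = x / (L + 1) * s%:R by ring.
have Ds : (D <= s)%N.
  rewrite -(ler_nat R); have : s%:R * x <= s%:R * 1 by rewrite ler_wpM2l.
  have : 0 <= D%:R * L by rewrite mulr_ge0.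
  lra.
have N1 : (nb_coeffs s D)%:R * x ^+ D <= (1 + x) ^+ s.
  by apply: nb_coeffs_le => //; rewrite x0.
have xD : x ^+ D = (expR (D%:R * L))^-1.
  by rewrite -expRN -mulrN opprK expRM_natl lnK.
have xs : (1 + x) ^+ s <= expR (s%:R * x).
  have px : 0 <= 1 + x by rewrite addr_ge0// ltW.
  by rewrite expRM_natl lerXn2r ?nnegrE ?expR_ge0 ?expR_ge1Dx.
have N2 : (nb_coeffs s D)%:R <= expR (2 * (s%:R * x)).
  have := le_trans N1 xs; rewrite xD ler_pdivrMr ?expR_gt0// -expRD.
  move=> /le_trans; apply; rewrite ler_expR.
  have : 0 <= D%:R :> R by []; lra.
apply: (@le_trans _ _ (expR (2 * (s%:R * x)) ^+ 2)).
  by rewrite lerXn2r ?nnegrE ?expR_ge0.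
rewrite -expRM_natl -[leRHS]lnK ?posrE// ler_expR.
have : s%:R * (4 * x) <= K * log2 n%:R * (4 * x).
  by rewrite ler_wpM2r// mulr_ge0// ltW.
have -> : K * log2 n%:R * (4 * x) = ln n%:R.
  by rewrite mulrAC [K * _]mulrC xK /log2 mulrCA mulfV ?mulr1// gt_eqF.
lra.
Qed.

Lemma balanced_of_sqr_le (B V K : R) s n D :
  0 < B -> 0 < V -> 0 < K -> (0 < resolvable_degree s n)%N ->
  s%:R <= K * log2 n%:R -> (nb_coeffs s D)%:R ^+ 2 <= n%:R :> R ->
  32 * V * K / (B * ln 2) <= ln n%:R -> 0 < ln n%:R :> R ->
  balanced s n B V D.
Proof.
move=> B0 V0 K0 D0 sn Nn yB y0; have l0 := ln2_gt0.
set y : R := ln n%:R in yB y0.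
have n0 : 0 < n%:R :> R.
  rewrite ltr0n lt0n; apply/eqP => n0; move: y0.
  by rewrite /y n0 ln0// ltxx.
pose r := expR (y / 2).
have r2 : r ^+ 2 = n%:R.
  rewrite /r -expRM_natl.
  have -> : 2 * (y / 2) = y by field.
  by rewrite /y lnK.
have r0 : 0 < r by exact: expR_gt0.
have ry : y ^+ 2 / 8 <= r.
  have h0 : 0 <= y / 2 by rewrite divr_ge0// ltW.
  by have := expR_ge_quad h0; rewrite -/r; lra.
have Nr : (nb_coeffs s D)%:R <= r.
  by rewrite -(@ler_pXn2r _ 2)// ?nnegrE ?(ltW r0)// r2.
have Ds : (resolvable_degree s n)%:R <= s%:R :> R.
  by rewrite ler_nat resolvable_degree_le.
have dR : 0 < (resolvable_degree s n)%:R :> R by rewrite ltr0n.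
rewrite /balanced ler_pdivrMr// mulrAC ler_pdivlMr ?mulr_gt0// -r2.
apply: (@le_trans _ _ (V * r * (4 * s%:R))).
  by apply: ler_pM; rewrite ?mulr_ge0 ?(ltW V0)// ?ler_wpM2l// ltW.
have yB8 : 4 * (V * K * y / ln 2) <= B * (y ^+ 2 / 8).
  move: yB; rewrite ler_pdivrMr ?mulr_gt0// => yB.
  rewrite mulrA ler_pdivrMr//.
  have := ler_wpM2r (ltW y0) yB; lra.
have : V * s%:R <= V * K * y / ln 2.
  by rewrite -!mulrA ler_pM2l// mulrA -[K * y / _]mulrA.
move=> Vs; have : 4 * (V * s%:R) <= B * r.
  apply: le_trans (ler_wpM2l _ Vs) _ => //; apply: le_trans yB8 _.
  by rewrite ler_pM2l.
move=> /(ler_wpM2r (ltW r0)); lra.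
Qed.

Lemma pow2_ge (eps : R) s n : 0 < eps -> (0 < n)%N ->
  (1 + eps) * log2 n%:R <= s%:R -> 1 <= eps * ln n%:R -> (n * 2 <= 2 ^ s)%N.
Proof.
move=> e0 n0 ns en; have l0 := ln2_gt0.
have nR : 0 < n%:R :> R by rewrite ltr0n.
rewrite -(ler_nat R) natrM natrX.
have -> : 2 ^+ s = expR (s%:R * ln 2) :> R by rewrite expRM_natl lnK// posrE.
have : (1 + eps) * ln n%:R <= s%:R * ln 2.
  by rewrite -ler_pdivrMr// -mulrA.
rewrite -ler_expR => /(le_trans _); apply.
rewrite mulrDl mul1r expRD lnK ?posrE// ler_pM2l//.
have := expR_ge1Dx (eps * ln n%:R); lra.
Qed.

End constants.

Theorem theorem4p4 (R : realType) (eps C0 : R) (eps_gt0 : 0 < eps) :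
  exists c C : R, [/\ 0 < c, c < C &
    forall B sigma2 : R, 0 < B -> 0 < sigma2 ->
    exists n0 : nat, forall n s : nat, (n0 <= n)%N ->
      (1 + eps) * log2 n%:R <= s%:R <= C0 * log2 n%:R ->
      let V := sigma2 + 1 in
      let Dsharp := balanced_cutoff s n B V in
      [/\ ((c * (B / s%:R))%:E <= minimax_risk n sigma2 (@mono_class R s B))%E,
          (minimax_risk n sigma2 (@mono_class R s B) <= (C * (B / s%:R))%:E)%E,
          cutoff_defined s n B V
        & (worst_risk sigma2 (@mono_class R s B)
             (@clipped_proj R s n Dsharp) <= (C * (B / s%:R))%:E)%E]].
Proof.
pose K := Num.max C0 1.
have K1 : 1 <= K by rewrite le_max lexx orbT.
have K0 : 0 < K by exact: lt_le_trans K1.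
have [delta /andP[d0 d1] deltaP] := nb_coeffs_sqr_le K1.
have dV1 : 1 <= delta^-1 by rewrite invf_ge1.
exists (1 / 16), delta^-1; split; [lra|lra|].
move=> B sigma2 B0 s20; pose V := sigma2 + 1.
have V0 : 0 < V by rewrite addr_gt0.
have l0 := ln2_gt0 R; have l1 := ln2_le1 R.
pose T := 32 * V * K / (B * ln 2).
have T0 : 0 <= T by rewrite divr_ge0 ?mulr_ge0// ltW.
(* the terms of [Y] secure in turn [1 < s], an amplitude at most [1] on the
   middle layer, a positive degree [D], [2 n <= 2^s], and the balance at [D] *)
pose Y := 2 + 2 * B ^+ 2 + delta^-1 + eps^-1 + T.
exists (Num.bound (expR Y)) => n s nY /andP[sn_lo sn_hi] /=; rewrite -/V.
have eV0 : 0 < eps^-1 by rewrite invr_gt0.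
have B20 : 0 <= B ^+ 2 by exact: sqr_ge0.
have expY : expR Y <= n%:R.
  apply: le_trans (ltW (archi_boundP (expR_ge0 Y))) _.
  by rewrite ler_nat.
have nR : 0 < n%:R :> R by apply: lt_le_trans expY; exact: expR_gt0.
have n0 : (0 < n)%N by rewrite -(ltr0n R).
set y : R := ln n%:R.
have Yy : Y <= y by rewrite -ler_expR lnK.
have y0 : 0 < y by rewrite (lt_le_trans _ Yy)// /Y; lra.
have ylog : y <= log2 n%:R by rewrite /log2 ler_pdivlMr// -/y ler_piMr// ltW.
have log0 : 0 < log2 n%:R :> R by exact: lt_le_trans ylog.
have ys : y <= s%:R.
  apply: le_trans sn_lo; rewrite mulrDl mul1r (le_trans ylog)// lerDl.
  by rewrite mulr_ge0// ltW.
have snK : s%:R <= K * log2 n%:R.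
  by apply: le_trans sn_hi _; rewrite ler_pM2r// le_max lexx.
have s1 : (1 < s)%N.
  by rewrite -(ltr_nat R) (lt_le_trans _ ys)// (lt_le_trans _ Yy)// /Y; lra.
have ds1 : 1 <= delta * s%:R.
  by rewrite mulrC -ler_pdivrMr// mul1r (le_trans _ ys)// (le_trans _ Yy)// /Y; lra.
pose D := Num.truncn (delta * s%:R).
have /andP[D_le D_ge] : D%:R <= delta * s%:R < D.+1%:R.
  by apply: truncn_itv; exact: le_trans ds1.
have D1 : (0 < D)%N by rewrite truncn_gt0.
have Ds : (D <= s)%N.
  by rewrite -(ler_nat R) (le_trans D_le)// ler_piMl.
have N2 := deltaP s n D n0 snK D_le.
have Nn : (nb_coeffs s D <= n)%N.
  have : (nb_coeffs s D ^ 2 <= n)%N by rewrite -(ler_nat R) natrX.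
  by apply: leq_trans; case: nb_coeffs => // N; rewrite leq_pmulr.
have DD : (D <= resolvable_degree s n)%N by exact: resolvable_degree_ge.
have R0 : (0 < resolvable_degree s n)%N by exact: leq_trans DD.
have bD : balanced s n B V D.
  apply: (balanced_of_sqr_le (K := K)) => //.
  by apply: le_trans Yy; rewrite /Y -/T; lra.
have upper : (worst_risk sigma2 (@mono_class R s B)
    (@clipped_proj R s n (balanced_cutoff s n B V)) <= (delta^-1 * (B / s%:R))%:E)%E.
  by apply: (worst_risk_clipped_le (D := D)); rewrite ?D1 ?(ltW D_ge)// ltnW.
split=> //.
- apply: minimax_risk_mono_class_ge => //; first exact: ltW.
    by rewrite (le_trans _ ys)// (le_trans _ Yy)// /Y; lra.
  apply: (pow2_ge eps_gt0 n0 sn_lo).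
  rewrite mulrC -ler_pdivrMr// mul1r (le_trans _ Yy)// /Y; lra.
- apply: ge_ereal_inf; exists (worst_risk sigma2 (@mono_class R s B)
    (@clipped_proj R s n (balanced_cutoff s n B V))) => //.
  by exists (@clipped_proj R s n (balanced_cutoff s n B V)) => //;
     exact: clipped_proj_estimator.
- by split=> //; exists D.
Qed.
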